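(* Let $\nu\ge 2$, let $\mathcal{X}=\{0,1\}^\nu$, and consider the generalized linear model with $\boldsymbol{f}(\boldsymbol{x})=(1,x_1,\dots,x_\nu)^{\mathsf T}$ for $\boldsymbol{x}=(x_1,\dots,x_\nu)^{\mathsf T}\in\mathcal{X}$. Denote $\boldsymbol{x}_1^*=(0,\dots,0)^{\mathsf T}$ and, for $1\le i\le\nu$, let $\boldsymbol{x}_{i+1}^*$ be the $i$-th unit vector of $\mathbb{R}^\nu$. For a given parameter point $\boldsymbol{\beta}=(\beta_0,\beta_1,\dots,\beta_\nu)^{\mathsf T}$ let $u_i=u(\boldsymbol{x}_i^*,\boldsymbol{\beta})$ and $q_i=u_i^{-1/2}$ for $1\le i\le\nu+1$. Then the design $\xi^*$ supported by $\boldsymbol{x}_i^*$ ($1\le i\le\nu+1$) with weights $$\omega_1^*=\sqrt{\nu+1}\,q_1/c,\qquad \omega_{i+1}^*=q_{i+1}/c\ \ (1\le i\le\nu),\qquad c=\sqrt{\nu+1}\,q_1+\sum_{i=2}^{\nu+1}q_i,$$ is locally A-optimal (at $\boldsymbol{\beta}$) if and only if for all $\boldsymbol{x}=(x_1,\dots,x_\nu)^{\mathsf T}\in\{0,1\}^\nu$ $$q_1^2\Bigl(1-\sum_{j=1}^\nu x_j\Bigr)^2+\sum_{i=1}^\nu q_{i+1}^2x_i^2+\frac{2q_1}{\sqrt{\nu+1}}\Bigl(\sum_{j=1}^\nu x_j-1\Bigr)\sum_{i=1}^\nu q_{i+1}x_i\le u^{-1}(\boldsymbol{x},\boldsymbo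l{\beta}).$$
   Context: Here $u^{-1}(\boldsymbol{x},\boldsymbol{\beta})=1/u(\boldsymbol{x},\boldsymbol{\beta})$. Setting: $\mathcal{X}\subseteq\mathbb{R}^\nu$ is the experimental region, $\boldsymbol{f}:\mathcal{X}\to\mathbb{R}^p$ is the regression function and $\boldsymbol{\beta}\in\mathbb{R}^p$ the parameter vector (here $p=\nu+1$). The intensity function $u(\boldsymbol{x},\boldsymbol{\beta})$ of the generalized linear model is a positive function which depends on $(\boldsymbol{x},\boldsymbol{\beta})$ only through the value of the linear predictor $\boldsymbol{f}^{\mathsf T}(\boldsymbol{x})\boldsymbol{\beta}$ (it is $u=(\mathrm{var}(Y)(\mathrm{d}\eta/\mathrm{d}\mu)^2)^{-1}$, where $\eta=g(\mu)=\boldsymbol{f}^{\mathsf T}(\boldsymbol{x})\boldsymbol{\beta}$, $\mu$ is the mean of the response $Y$ and $g$ the link function). A design $\xi$ is a probability measure with finite support on $\mathcal{X}$, given by pairwise distinct support points $\boldsymbol{x}_1,\dots,\boldsymbol{x}_r\in\mathcal{X}$ with weights $\omega_1,\dots,\omega_r>0$, $\sum_i\omega_i=1$. Its information matrix at $\boldsymbol{\beta}$ is $\boldsymbol{M}(\xi,\boldsymbol{\beta})=\sum_{i=1}^r\omega_i\,u(\boldsymbol{x}_i,\boldsymbol{\beta})\,\boldsymbol{f}(\boldsymbol{x}_i)\boldsymbol{f}^{\mathsf T}(\boldsymbol{x}_i)$. A design is locally A-optimal (at $\boldsymbol{\beta}$) if it minimizes $\mathrm{tr}(\boldsymbol{M}^{-1}(\xi,\boldsymbol{\beta}))$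 over all designs $\xi$ on $\mathcal{X}$ whose information matrix is nonsingular. *)

(* Defs.v *)
From HB Require Import structures.
From mathcomp Require Import all_boot all_order all_algebra.
From mathcomp Require Import classical_sets reals.

Set Implicit Arguments.
Unset Strict Implicit.
Unset Printing Implicit Defensive.

Import Order.TTheory GRing.Theory Num.Theory.
Local Open Scope classical_set_scope.
Local Open Scope ring_scope.

(* Only the data of a design; the constraints are in [is_design]. *)
Record design_data (R : realType) (nu : nat) := DesignData {
  dsize : nat;
  dpoint : 'I_dsize -> 'cV[R]_nu;
  dweight : 'I_dsize -> R
}.
Arguments DesignData {R nu dsize}.
Arguments dpoint {R nu} d.
Arguments dweight {R nu} d.

Definition is_design (R : realType) (nu : nat) (X : set 'cV[R]_nu)
    (xi : design_data R nu) : Prop :=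
  [/\ injective (dpoint xi),
      forall i, X (dpoint xi i),
      forall i, 0 < dweight xi i
    & \sum_i dweight xi i = 1].

(* [u] is positive and depends on (x, beta) only through f(x)^T beta. *)
Definition is_intensity (R : realType) (nu p : nat) (X : set 'cV[R]_nu)
    (f : 'cV[R]_nu -> 'cV[R]_p) (u : 'cV[R]_nu -> 'cV[R]_p -> R) : Prop :=
  (forall x beta, X x -> 0 < u x beta) /\
  (forall x x' beta beta', X x -> X x' ->
     (f x)^T *m beta = (f x')^T *m beta' -> u x beta = u x' beta').

Definition info_mx (R : realType) (nu p : nat)
    (f : 'cV[R]_nu -> 'cV[R]_p) (u : 'cV[R]_nu -> 'cV[R]_p -> R)
    (xi : design_data R nu) (beta : 'cV[R]_p) : 'M[R]_p :=
  \sum_i (dweight xi i * u (dpoint xi i) beta) *: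
    (f (dpoint xi i) *m (f (dpoint xi i))^T).

Definition locally_A_optimal (R : realType) (nu p : nat) (X : set 'cV[R]_nu)
    (f : 'cV[R]_nu -> 'cV[R]_p) (u : 'cV[R]_nu -> 'cV[R]_p -> R)
    (beta : 'cV[R]_p) (xi : design_data R nu) : Prop :=
  [/\ is_design X xi,
      info_mx f u xi beta \in unitmx
    & forall xi' : design_data R nu,
        is_design X xi' -> info_mx f u xi' beta \in unitmx ->
        \tr (invmx (info_mx f u xi beta)) <= \tr (invmx (info_mx f u xi' beta))].

Definition binary_cube (R : realType) (nu : nat) : set 'cV[R]_nu :=
  [set x | forall i, x i 0 = 0 \/ x i 0 = 1].

(* [col_mx 1%:M x] has type 'cV_(1 + nu), which is convertible to 'cV_nu.+1. *)
Definition first_order (R : realType) (nu : nat) (x : 'cV[R]_nu) :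
    'cV[R]_nu.+1 :=
  col_mx 1%:M x.

(* The index set {1, ..., nu+1} is 'I_nu.+1 shifted down by one: [ord0] stands
   for 1 and [lift ord0 i] for i+1. *)
Definition xstar (R : realType) (nu : nat) (k : 'I_nu.+1) : 'cV[R]_nu :=
  if unlift ord0 k is Some i then delta_mx i 0 else 0.

Definition qstar (R : realType) (nu : nat)
    (u : 'cV[R]_nu -> 'cV[R]_nu.+1 -> R) (beta : 'cV[R]_nu.+1)
    (k : 'I_nu.+1) : R :=
  (Num.sqrt (u (xstar R k) beta))^-1.

Definition cstar (R : realType) (nu : nat)
    (u : 'cV[R]_nu -> 'cV[R]_nu.+1 -> R) (beta : 'cV[R]_nu.+1) : R :=
  Num.sqrt nu.+1%:R * qstar u beta ord0
    + \sum_(i < nu) qstar u beta (lift ord0 i).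

Definition wstar (R : realType) (nu : nat)
    (u : 'cV[R]_nu -> 'cV[R]_nu.+1 -> R) (beta : 'cV[R]_nu.+1)
    (k : 'I_nu.+1) : R :=
  if unlift ord0 k is Some i then qstar u beta (lift ord0 i) / cstar u beta
  else Num.sqrt nu.+1%:R * qstar u beta ord0 / cstar u beta.

Definition xistar (R : realType) (nu : nat)
    (u : 'cV[R]_nu -> 'cV[R]_nu.+1 -> R) (beta : 'cV[R]_nu.+1) :
    design_data R nu :=
  DesignData (@xstar R nu) (wstar u beta).

(* Main.v *)
Require Import Defs.
From HB Require Import structures.
From mathcomp Require Import all_boot all_order all_algebra.
From mathcomp Require Import classical_sets reals.
From mathcomp Require Import ring lra.

Set Implicit Arguments.
Unset Strict Implicit.
Unset Printing Implicit Defensive.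

Import Order.TTheory GRing.Theory Num.Theory.
Local Open Scope ring_scope.

(** The theorem is the A-optimality version of the Kiefer-Wolfowitz
    equivalence theorem, evaluated at a design supported by the vertices of a
    simplex.

    Equivalence theorem.  Let N be the inverse of the information matrix M of a
    design xi.  Then xi is locally A-optimal iff u(x) |N f(x)|^2 <= tr N for
    every x in the experimental region ([A_optimalP]).
    - If the inequality holds and M' is the information matrix of another
      design, then tr (N M' N) is an average of the numbers u(x) |N f(x)|^2,
      hence at most tr N.  Since M' is positive semidefinite,
      0 <= tr ((M'^-1 - N) M' (M'^-1 - N)) = tr M'^-1 - 2 tr N + tr (N M' N),
      so tr N <= tr M'^-1 ([A_optimal_suff]).  This replaces the usual
      convexity argument by completing a square.
    - Conversely, move a small mass t from xi to a point x.  The new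
      information matrix is a rank-one update of (1 - t) M, so the
      Sherman-Morrison formula gives the trace of its inverse in closed form;
      optimality of xi then yields the inequality up to an error O(t)
      ([A_optimal_nec]).

    Simplex design.  The regression vectors f(x_k) form a matrix A whose
    inverse B sends f(x) to the barycentric coordinates
    (1 - sum x_j, x_1, ..., x_nu) of x ([bary_mx_first_order]).  As the design
    is saturated, M = A D A^T with D diagonal, and N = B^T D^-1 B is explicit
    ([xistar_invmx]).  With the weights omega_k proportional to q_k times the
    norm of the k-th row of B, the square |N f(x)|^2 is c^2 times the left-hand
    side of the claimed inequality ([xistar_sensitivity]), and tr N = c^2
    ([xistar_mxtrace]); dividing by c^2 u(x) gives the theorem. *)

(** * Squared norms and rank-one updates *)

Definition sqnorm (R : realDomainType) (m : nat) (v : 'cV[R]_m) : R :=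
  \sum_i v i 0 ^+ 2.

Lemma sqnorm_ge0 (R : realDomainType) (m : nat) (v : 'cV[R]_m) : 0 <= sqnorm v.
Proof. by apply: sumr_ge0 => i _; apply: sqr_ge0. Qed.

Lemma mxtrace_outer (R : realDomainType) (m : nat) (v : 'cV[R]_m) :
  \tr (v *m v^T) = sqnorm v.
Proof. by apply: eq_bigr => i _; rewrite !mxE big_ord1 mxE expr2. Qed.

(** Sherman-Morrison: with y = M^-1 z one has M (y y^T) = z y^T and
    z z^T (y y^T) = g z y^T, so the product is 1 plus a multiple of z y^T, and
    the coefficient b / (a + b g) makes that multiple vanish. *)
Lemma rank1_update_mulV (R : fieldType) (p : nat) (M : 'M[R]_p) (z : 'cV[R]_p)
    (a b : R) :
  let y := invmx M *m z in let g := (y^T *m z) 0 0 in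
  M \in unitmx -> M^T = M -> a != 0 -> a + b * g != 0 ->
  (a *: M + b *: (z *m z^T))
    *m (a^-1 *: (invmx M - (b / (a + b * g)) *: (y *m y^T))) = 1%:M.
Proof.
move=> y g uM sM a0 ag0.
have My : M *m y = z by rewrite mulKVmx.
have yT : z^T *m invmx M = y^T by rewrite trmx_mul trmx_inv sM.
have zy : z^T *m y = g%:M.
  by rewrite [LHS]mx11_scalar -[z^T *m y]trmxK trmx_mul trmxK [LHS]/= mxE.
rewrite -scalemxAr mulmxBr !mulmxDl -!scalemxAl -!scalemxAr.
rewrite mulmxV // (mulmxA M) My -!(mulmxA z) yT (mulmxA z^T) zy mul_scalar_mx.
rewrite -!scalemxAr; move: (z *m y^T) => E.
apply/matrixP => i j; rewrite !mxE; move: (E i j) (_%:R) => e d.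
by field; rewrite a0 ag0.
Qed.

(** * The equivalence theorem for A-optimality *)

Section Designs.
Variables (R : realType) (nu p : nat) (X : set 'cV[R]_nu).
Variables (f : 'cV[R]_nu -> 'cV[R]_p) (u : 'cV[R]_nu -> 'cV[R]_p -> R).
Variable beta : 'cV[R]_p.
Hypothesis u_gt0 : forall x, X x -> 0 < u x beta.

Lemma info_mx_sym (xi : design_data R nu) :
  (info_mx f u xi beta)^T = info_mx f u xi beta.
Proof.
rewrite /info_mx linear_sum; apply: eq_bigr => i _ /=.
by rewrite linearZ /= trmx_mul trmxK.
Qed.

(** The information matrix enters the whole argument only through this formula:
    it gives positive semidefiniteness, and it turns tr (N M' N) into an average
    of the sensitivity u(x) |N f(x)|^2 over the design xi'. *)
Lemma mxtrace_info_congr (xi : design_data R nu) (m : nat) (C : 'M[R]_(m, p)) :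
  \tr (C *m info_mx f u xi beta *m C^T)
  = \sum_i dweight xi i * u (dpoint xi i) beta * sqnorm (C *m f (dpoint xi i)).
Proof.
rewrite /info_mx mulmx_sumr mulmx_suml linear_sum; apply: eq_bigr => i _ /=.
rewrite -scalemxAr -scalemxAl mxtraceZ -mxtrace_outer trmx_mul.
by rewrite !mulmxA.
Qed.

Lemma mxtrace_info_congr_ge0 (xi : design_data R nu) (m : nat)
    (C : 'M[R]_(m, p)) :
  is_design X xi -> 0 <= \tr (C *m info_mx f u xi beta *m C^T).
Proof.
case=> _ inX w_gt0 _; rewrite mxtrace_info_congr; apply: sumr_ge0 => i _.
by rewrite mulr_ge0 ?sqnorm_ge0 // mulr_ge0 ?ltW // u_gt0.
Qed.

(** By symmetry, M^-1 = M^-1 M (M^-1)^T. *)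
Lemma mxtrace_invmx_ge0 (xi : design_data R nu) :
  is_design X xi -> info_mx f u xi beta \in unitmx ->
  0 <= \tr (invmx (info_mx f u xi beta)).
Proof.
move=> dxi uM; have := mxtrace_info_congr_ge0 (invmx (info_mx f u xi beta)) dxi.
by rewrite trmx_inv info_mx_sym mulVmx // mul1mx.
Qed.

(** The mixture (1 - t) xi + t delta_x.  Support points of a design are pairwise
    distinct, so if x already lies in the support its weight has to be increased
    instead of appending a new point. *)
Lemma design_mix (xi : design_data R nu) (x : 'cV[R]_nu) (t : R) :
  is_design X xi -> X x -> 0 < t -> t < 1 ->
  exists2 xi' : design_data R nu, is_design X xi' &
    info_mx f u xi' beta
    = (1 - t) *: info_mx f u xi beta + (t * u x beta) *: (f x *m (f x)^T).
Proof.
move=> [inj inX w_gt0 sum1] Xx t0 t1; have t1' : 0 < 1 - t by rewrite subr_gt0.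
have [/existsP [i0 /eqP xi0]|/existsPn nx] := boolP [exists i, dpoint xi i == x].
  exists (DesignData (dpoint xi)
            (fun i => (1 - t) * dweight xi i + t * (i == i0)%:R)).
    split => //= [i|].
      by rewrite ltr_pwDl ?mulr_gt0 // mulr_ge0 ?ler0n // ltW.
    rewrite big_split /= -!mulr_sumr sum1 (bigD1 i0) //= eqxx big1 => [|i /negPf-> //].
    by rewrite /= addr0 !mulr1 subrK.
  rewrite /info_mx /= scaler_sumr.
  under eq_bigr do rewrite mulrDl scalerDl.
  rewrite big_split /=; congr (_ + _).
    by apply: eq_bigr => i _; rewrite scalerA mulrA.
  rewrite (bigD1 i0) //= eqxx big1 => [|i /negPf->].
    by rewrite mulr1 addr0 xi0.
  by rewrite mulr0 mul0r scale0r.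
exists (DesignData
  (fun k => if unlift ord0 k is Some i then dpoint xi i else x)
  (fun k => if unlift ord0 k is Some i then (1 - t) * dweight xi i else t)).
  split => /= [j k|k|k|].
  - case: unliftP => [i|] ->; case: unliftP => [i'|] -> //.
    + by move/inj ->.
    + by move=> e; case/negP: (nx i); apply/eqP.
    + by move=> e; case/negP: (nx i'); apply/eqP.
  - by case: unliftP.
  - by case: unliftP => [i|] _ //; rewrite mulr_gt0.
  - rewrite big_ord_recl unlift_none.
    under eq_bigr do rewrite liftK.
    by rewrite -mulr_sumr sum1; ring.
rewrite /info_mx /= big_ord_recl unlift_none addrC; congr (_ + _).
rewrite scaler_sumr; apply: eq_bigr => i _.
by rewrite liftK scalerA mulrA.
Qed.

(** Completing the square: the positive semidefinite M' is tested against
    M'^-1 - N, where the sensitivity bound makes tr (N M' N) <= tr N. *)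
Lemma A_optimal_suff (xi : design_data R nu) :
  let N := invmx (info_mx f u xi beta) in
  is_design X xi -> info_mx f u xi beta \in unitmx ->
  (forall x, X x -> u x beta * sqnorm (N *m f x) <= \tr N) ->
  locally_A_optimal X f u beta xi.
Proof.
move=> N dxi uM sens; split=> // xi' dxi' uM'.
have [_ inX w_gt0 sum1] := dxi'.
set M' := info_mx f u xi' beta in uM' *.
have NT : N^T = N by rewrite trmx_inv info_mx_sym.
have M'T : (invmx M')^T = invmx M' by rewrite trmx_inv info_mx_sym.
have NMN : \tr (N *m M' *m N) <= \tr N.
  rewrite -{2}NT mxtrace_info_congr -[leRHS]mul1r -sum1 mulr_suml.
  apply: ler_sum => i _; rewrite -mulrA.
  by apply: ler_wpM2l; [exact: ltW|exact: sens].
have := mxtrace_info_congr_ge0 (invmx M' - N) dxi'.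
rewrite -/M' linearB /= M'T NT mulmxBl mulVmx // mulmxBr !mulmxBl !mul1mx mulmxK //.
by rewrite !linearB /= -/N; lra.
Qed.

(** First-order condition in the direction of the one-point design at x,
    obtained from the exact trace along the segment rather than by
    differentiation. *)
Lemma A_optimal_nec (xi : design_data R nu) (x : 'cV[R]_nu) :
  let N := invmx (info_mx f u xi beta) in
  locally_A_optimal X f u beta xi -> X x ->
  u x beta * sqnorm (N *m f x) <= \tr N.
Proof.
move=> N [dxi uM opt] Xx; set y := N *m f x; set T := \tr N.
have ux := u_gt0 Xx.
set g := (y^T *m f x) 0 0.
have g_ge0 : 0 <= g.
  have := mxtrace_info_congr_ge0 y^T dxi.
  rewrite trmxK -mulmxA mulKVmx // /g.
  by rewrite /mxtrace big_ord1.
have T_ge0 : 0 <= T by apply: mxtrace_invmx_ge0.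
have step t : 0 < t -> t < 1 ->
    u x beta * sqnorm y <= T * (1 - t + t * u x beta * g).
  move=> t0 t1; have [xi' dxi' Mxi'] := design_mix dxi Xx t0 t1.
  have a0 : 0 < 1 - t by rewrite subr_gt0.
  have ag0 : 0 < 1 - t + t * u x beta * g.
    by rewrite ltr_pwDl // mulr_ge0 // mulr_ge0 ?ltW.
  have inv := rank1_update_mulV uM (info_mx_sym xi) (lt0r_neq0 a0) (lt0r_neq0 ag0).
  rewrite -Mxi' in inv; have [uM' _] := mulmx1_unit inv.
  have := opt _ dxi' uM'.
  rewrite -[invmx (info_mx f u xi' beta)]mulmx1 -inv mulKmx // mxtraceZ linearB /=.
  rewrite mxtraceZ mxtrace_outer -/N -/y -/T -/g.
  (* By Sherman-Morrison both sides are now linear in tr N and |y|^2. *)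
  rewrite -(ler_pM2l a0) mulVKf ?lt0r_neq0 // => le.
  have {}le : t * u x beta / (1 - t + t * u x beta * g) * sqnorm y <= t * T by lra.
  rewrite -(ler_pM2l t0) mulrA (mulrA t T) -ler_pdivrMr //.
  by rewrite mulrAC.
(* If the inequality failed by e > 0, [step] would be violated as soon as
   t T u g < e; the chosen t makes the left side at most e / 2. *)
rewrite leNgt; apply/negP; rewrite -subr_gt0 => e_gt0.
set e := _ - _ in e_gt0; set P := T * (u x beta * g).
have P_ge0 : 0 <= P by rewrite !mulr_ge0 // ltW.
have eP : 0 < 2 * (e + P) by lra.
set t := e / (2 * (e + P)).
have tE : t * (2 * (e + P)) = e by rewrite /t divfK // lt0r_neq0.
have t0 : 0 < t by rewrite divr_gt0.
have t1 : t < 1 by rewrite ltr_pdivrMr // mul1r; lra.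
have := step t t0 t1.
have -> : T * (1 - t + t * u x beta * g) = T - t * T + t * P by rewrite /P; ring.
have : 0 <= t * T by rewrite mulr_ge0 // ltW.
have : 0 < t * e by rewrite mulr_gt0.
rewrite -/y -/T /e in tE *; nra.
Qed.

Lemma A_optimalP (xi : design_data R nu) :
  let N := invmx (info_mx f u xi beta) in
  is_design X xi -> info_mx f u xi beta \in unitmx ->
  locally_A_optimal X f u beta xi <->
  (forall x, X x -> u x beta * sqnorm (N *m f x) <= \tr N).
Proof.
by move=> N dxi uM; split; [move=> o x; apply: A_optimal_nec|apply: A_optimal_suff].
Qed.

(** Useful for a saturated design, where A is square and its inverse turns this
    into an explicit inverse of the information matrix. *)
Lemma info_mx_factor (xi : design_data R nu) :
  let A := \matrix_(a, k) f (dpoint xi k) a 0 in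
  info_mx f u xi beta
  = A *m diag_mx (\row_k (dweight xi k * u (dpoint xi k) beta)) *m A^T.
Proof.
apply/matrixP => a b; rewrite /info_mx summxE mul_mx_diag mxE.
by apply: eq_bigr => k _; rewrite !mxE big_ord1 !mxE; ring.
Qed.

End Designs.

(** * Barycentric coordinates of the simplex 0, e_1, ..., e_nu *)

(** The inverse of the matrix whose columns are the regression vectors (1, x) at
    the vertices x. *)
Definition bary_mx (R : realType) (nu : nat) : 'M[R]_nu.+1 :=
  block_mx (1%:M : 'M_1) (const_mx (-1)) 0 1%:M.

Lemma bary_mx_first_order (R : realType) (nu : nat) (x : 'cV[R]_nu) :
  bary_mx R nu *m first_order x = col_mx (1 - \sum_j x j 0)%:M x.
Proof.
have -> : (1 - \sum_j x j 0)%:M = 1%:M + const_mx (-1) *m x :> 'M[R]_1.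
  apply/matrixP => i j; rewrite !mxE !ord1 /= !mulr1n; congr (_ + _).
  by rewrite -sumrN; apply: eq_bigr => k _; rewrite !mxE mulN1r.
by rewrite [LHS](@mul_block_col _ 1 nu 1 nu) !mul1mx mul0mx add0r.
Qed.

(** The next two lemmas read [col_mx] through the shift [ord0], [lift ord0],
    whereas [col_mxEu] and [col_mxEd] use [lshift] and [rshift]. *)
Lemma col_mx0 (R : realType) (nu : nat) (a : 'cV[R]_1) (x : 'cV[R]_nu) :
  (col_mx a x : 'cV_nu.+1) ord0 0 = a 0 0.
Proof.
have e : ord0 = lshift nu (ord0 : 'I_1) by apply: val_inj.
apply: etrans (congr1 (fun k => (col_mx a x : 'cV_nu.+1) k 0) e) _.
exact: (@col_mxEu _ 1 nu 1).
Qed.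

Lemma col_mx_lift (R : realType) (nu : nat) (a : 'cV[R]_1) (x : 'cV[R]_nu) i :
  (col_mx a x : 'cV_nu.+1) (lift ord0 i) 0 = x i 0.
Proof.
have e : lift ord0 i = rshift 1 i by apply: val_inj.
apply: etrans (congr1 (fun k => (col_mx a x : 'cV_nu.+1) k 0) e) _.
exact: (@col_mxEd _ 1 nu 1).
Qed.

Section Simplex.
Variables (R : realType) (nu : nat).

Lemma xstar0 : xstar R (ord0 : 'I_nu.+1) = 0.
Proof. by rewrite /xstar unlift_none. Qed.

Lemma xstar_lift (i : 'I_nu) : xstar R (lift ord0 i) = delta_mx i 0.
Proof. by rewrite /xstar liftK. Qed.

Lemma xstar_inj : injective (@xstar R nu).
Proof.
have ne0 (i : 'I_nu) : delta_mx i 0 != 0 :> 'cV[R]_nu.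
  by apply/eqP => /matrixP/(_ i 0)/eqP; rewrite !mxE !eqxx oner_eq0.
move=> j k; rewrite /xstar.
case: unliftP => [i|] ->; case: unliftP => [i'|] -> //.
- move/matrixP/(_ i 0)/eqP; rewrite !mxE !eqxx andbT /=.
  by have [->|_] := eqVneq i i'; rewrite //= oner_eq0.
- by move/eqP; rewrite (negPf (ne0 i)).
- by move/eqP; rewrite eq_sym (negPf (ne0 i')).
Qed.

Lemma xstar_cube (k : 'I_nu.+1) : binary_cube (xstar R k).
Proof.
move=> i; rewrite /xstar; case: unliftP => [j|] _; rewrite mxE; last by left.
by case: (_ && _); [right|left].
Qed.

Lemma bary_mx_xstar (k : 'I_nu.+1) :
  bary_mx R nu *m first_order (xstar R k) = delta_mx k 0.
Proof.
rewrite bary_mx_first_order; apply/colP => l.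
have [i ->|->] := unliftP ord0 l; have [j ->|->] := unliftP ord0 k.
- by rewrite col_mx_lift xstar_lift !mxE (inj_eq (@lift_inj _ _)).
- by rewrite col_mx_lift xstar0 !mxE.
- rewrite col_mx0 xstar_lift !mxE /= mulr1n (bigD1 j) //= big1.
    by rewrite mxE !eqxx addr0 subrr.
  by move=> i ij; rewrite mxE (negPf ij).
- by rewrite col_mx0 xstar0 !mxE /= mulr1n big1 ?subr0 // => i _; rewrite mxE.
Qed.

End Simplex.

(** * The A-criterion of the simplex design *)

Section SimplexDesign.
Variables (R : realType) (nu : nat) (u : 'cV[R]_nu -> 'cV[R]_nu.+1 -> R).
Variable beta : 'cV[R]_nu.+1.
Hypothesis u_gt0 : forall x, binary_cube x -> 0 < u x beta.
Local Notation q := (qstar u beta).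
Local Notation c := (cstar u beta).
Local Notation M := (info_mx (@first_order R nu) u (xistar u beta) beta).
Local Notation B := (bary_mx R nu).
Local Notation s := (Num.sqrt nu.+1%:R : R).

Lemma ustar_gt0 k : 0 < u (xstar R k) beta.
Proof. exact: u_gt0 (xstar_cube _ _). Qed.

Lemma qstar_gt0 k : 0 < q k.
Proof. by rewrite invr_gt0 sqrtr_gt0 ustar_gt0. Qed.

Lemma qstar_sqr k : q k ^+ 2 = (u (xstar R k) beta)^-1.
Proof. by rewrite exprVn sqr_sqrtr // ltW // ustar_gt0. Qed.

Lemma sqrt_dim_gt0 : 0 < s.
Proof. by rewrite sqrtr_gt0 ltr0Sn. Qed.

Lemma sqrt_dim_sqr : s ^+ 2 = nu.+1%:R.
Proof. by rewrite sqr_sqrtr. Qed.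

Lemma cstar_gt0 : 0 < c.
Proof.
rewrite ltr_pwDl ?mulr_gt0 ?sqrt_dim_gt0 ?qstar_gt0 //.
by apply: sumr_ge0 => i _; rewrite ltW ?qstar_gt0.
Qed.

Lemma xistar_design : is_design (@binary_cube R nu) (xistar u beta).
Proof.
split=> /= [|k|k|]; [exact: xstar_inj|exact: xstar_cube| |].
  rewrite /wstar; case: unliftP => [i|] _.
    by rewrite divr_gt0 ?qstar_gt0 ?cstar_gt0.
  by rewrite divr_gt0 ?mulr_gt0 ?qstar_gt0 ?cstar_gt0 ?sqrt_dim_gt0.
rewrite big_ord_recl /wstar unlift_none.
under eq_bigr do rewrite liftK.
by rewrite -mulr_suml -mulrDl divff // lt0r_neq0 // cstar_gt0.
Qed.

(** The diagonal of D in the factorization M = A D A^T. *)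
Definition mass : 'rV[R]_nu.+1 :=
  \row_k (wstar u beta k * u (xstar R k) beta).

Lemma mass0 : mass 0 ord0 = s / (c * q ord0).
Proof.
have q0 := lt0r_neq0 (qstar_gt0 ord0); have c0 := lt0r_neq0 cstar_gt0.
rewrite mxE /wstar unlift_none -[u _ _]invrK -qstar_sqr.
by field; rewrite q0 c0.
Qed.

Lemma mass_lift i : mass 0 (lift ord0 i) = (c * q (lift ord0 i))^-1.
Proof.
have q0 := lt0r_neq0 (qstar_gt0 (lift ord0 i)).
have c0 := lt0r_neq0 cstar_gt0.
rewrite mxE /wstar liftK -[u _ _]invrK -qstar_sqr.
by field; rewrite q0 c0.
Qed.

Lemma mass_neq0 k : mass 0 k != 0.
Proof.
have [i ->|->] := unliftP ord0 k.
  by rewrite mass_lift invr_eq0 lt0r_neq0 // mulr_gt0 ?cstar_gt0 ?qstar_gt0.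
by rewrite mass0 lt0r_neq0 // divr_gt0 ?mulr_gt0 ?cstar_gt0 ?qstar_gt0 ?sqrt_dim_gt0.
Qed.

Definition inv_mass : 'rV[R]_nu.+1 := \row_k (mass 0 k)^-1.

(** M = A D A^T with A B = 1. *)
Lemma xistar_info_mulV : M *m (B^T *m diag_mx inv_mass *m B) = 1%:M.
Proof.
rewrite info_mx_factor -/mass; set A := \matrix_(a, k) _.
have BA : B *m A = 1%:M.
  apply/matrixP => i k; rewrite !mxE.
  have /colP/(_ i) := bary_mx_xstar R k; rewrite !mxE eqxx andbT => <-.
  by apply: eq_bigr => a _; rewrite !mxE.
have AB : A *m B = 1%:M := mulmx1C BA.
have DD : diag_mx mass *m diag_mx inv_mass = 1%:M.
  apply/matrixP => i j; rewrite mul_diag_mx !mxE; case: eqP => [->|_] /=.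
    by have := mass_neq0 j; rewrite !mxE mulr1n => /mulfV.
  by rewrite mulr0n mulr0.
have ABT : A^T *m B^T = 1%:M by rewrite -trmx_mul BA trmx1.
rewrite /mass in DD.
by rewrite !mulmxA -(mulmxA _ A^T) ABT mulmx1 -(mulmxA A) DD mulmx1 AB.
Qed.

Lemma xistar_info_unit : M \in unitmx.
Proof. by have [] := mulmx1_unit xistar_info_mulV. Qed.

Lemma xistar_invmx : invmx M = B^T *m diag_mx inv_mass *m B.
Proof. by rewrite -[RHS](mulKmx xistar_info_unit) xistar_info_mulV mulmx1. Qed.

Lemma tr_bary_mx_mul (a : 'cV[R]_1) (v : 'cV[R]_nu) :
  B^T *m col_mx a v = col_mx a (v - const_mx (a 0 0)).
Proof.
have -> : v - const_mx (a 0 0) = (const_mx (-1) : 'rV_nu)^T *m a + v.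
  rewrite addrC; congr (_ + _); apply/matrixP => i j.
  by rewrite !mxE big_ord1 !mxE !ord1 mulN1r.
rewrite /bary_mx (@tr_block_mx _ 1 nu 1 nu) [LHS](@mul_block_col _ 1 nu 1 nu).
by rewrite trmx0 !trmx1 !mul1mx mul0mx addr0.
Qed.

(** Put a = c q_1 (1 - sum x_j) / sqrt (nu + 1) and v_i = c q_(i+1) x_i, so that
    (a, v) is D^-1 applied to the barycentric coordinates of x.  Then N f(x) has
    coordinates a and v_i - a.  In its squared norm a^2 occurs nu + 1 times,
    which cancels the square root, and the cross terms - 2 a v_i give the mixed
    term of the inequality. *)
Lemma xistar_sensitivity (x : 'cV[R]_nu) :
  sqnorm (invmx M *m first_order x)
  = c ^+ 2 * (q ord0 ^+ 2 * (1 - \sum_(j < nu) x j 0) ^+ 2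
       + \sum_(i < nu) q (lift ord0 i) ^+ 2 * x i 0 ^+ 2
       + 2 * q ord0 / s
           * (\sum_(j < nu) x j 0 - 1) * (\sum_(i < nu) q (lift ord0 i) * x i 0)).
Proof.
have s0 := lt0r_neq0 sqrt_dim_gt0.
set S := \sum_(j < nu) x j 0.
pose a := c * q ord0 / s * (1 - S).
pose v := \col_i (c * q (lift ord0 i) * x i 0).
have -> : invmx M *m first_order x = col_mx a%:M (v - const_mx a) :> 'cV_nu.+1.
  have -> : invmx M *m first_order x = B^T *m col_mx a%:M v.
    rewrite xistar_invmx -!mulmxA bary_mx_first_order; congr (_ *m _).
    apply/colP => k; rewrite mul_diag_mx mxE.
    have [i ->|->] := unliftP ord0 k.
      by rewrite !col_mx_lift mxE mass_lift invrK mxE.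
    rewrite !col_mx0 mxE mass0 !mxE eqxx /= !mulr1n invf_div.
    by rewrite /a.
  by rewrite tr_bary_mx_mul mxE eqxx mulr1n.
rewrite /sqnorm big_ord_recl col_mx0 mxE eqxx mulr1n.
have -> : \sum_(i < nu) (col_mx a%:M (v - const_mx a) : 'cV_nu.+1) (lift ord0 i) 0 ^+ 2
   = c ^+ 2 * \sum_i q (lift ord0 i) ^+ 2 * x i 0 ^+ 2
     - 2 * a * c * \sum_i q (lift ord0 i) * x i 0 + nu%:R * a ^+ 2.
  have <- : \sum_(i < nu) a ^+ 2 = nu%:R * a ^+ 2.
    by rewrite sumr_const card_ord mulr_natl.
  rewrite !mulr_sumr -sumrB -big_split.
  by apply: eq_bigr => i _ /=; rewrite col_mx_lift !mxE; ring.
have -> : nu%:R = s ^+ 2 - 1 by rewrite sqrt_dim_sqr -natr1 addrK.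
by rewrite /a; field.
Qed.

(** The sensitivity is constant on the support: there the left-hand side of the
    claimed inequality reduces to q_k^2 = 1 / u_k. *)
Lemma xistar_support_sensitivity (k : 'I_nu.+1) :
  u (xstar R k) beta * sqnorm (invmx M *m first_order (xstar R k)) = c ^+ 2.
Proof.
rewrite xistar_sensitivity mulrCA -[RHS]mulr1; congr (_ * _).
apply: etrans (mulfV (lt0r_neq0 (ustar_gt0 k))).
rewrite -qstar_sqr; congr (_ * _).
(* At the origin only the first term survives, at a unit vector only the
   second one. *)
have [i ->|->] := unliftP ord0 k; last first.
  rewrite xstar0 !big1 => [|i _|i _|i _]; rewrite ?mxE ?expr0n ?mulr0 //.
  by rewrite subr0 expr1n mulr1 !addr0.
have sum_unit (F : 'I_nu -> R) :
    \sum_j F j * (delta_mx i 0 : 'cV[R]_nu) j 0 = F i.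
  rewrite (bigD1 i) //= big1 => [|j /negPf ji]; rewrite mxE ?ji ?eqxx ?mulr0 //.
  by rewrite mulr1 addr0.
have sumx : \sum_(j < nu) (delta_mx i 0 : 'cV[R]_nu) j 0 = 1.
  by rewrite -(sum_unit (fun=> 1)); apply: eq_bigr => j _; rewrite mul1r.
rewrite xstar_lift sumx !subrr expr0n !mulr0 mul0r addr0 add0r.
rewrite -(sum_unit (fun j => q (lift ord0 j) ^+ 2)).
by apply: eq_bigr => j _; rewrite !mxE -natrX; case: (_ && _).
Qed.

(** tr N = tr (N M N) is the average of the sensitivity over the design itself,
    and on the support the sensitivity is c^2. *)
Lemma xistar_mxtrace : \tr (invmx M) = c ^+ 2.
Proof.
have NT : (invmx M)^T = invmx M by rewrite trmx_inv info_mx_sym.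
have [_ _ _ sum1] := xistar_design.
have -> : \tr (invmx M) = \tr (invmx M *m M *m (invmx M)^T).
  by rewrite mulVmx ?xistar_info_unit // mul1mx NT.
rewrite mxtrace_info_congr -[RHS]mul1r -sum1 mulr_suml.
by apply: eq_bigr => k _; rewrite -mulrA xistar_support_sensitivity.
Qed.

End SimplexDesign.

Theorem theorem5p4 (R : realType) (nu : nat) (hnu : (2 <= nu)%N)
    (u : 'cV[R]_nu -> 'cV[R]_nu.+1 -> R)
    (hu : is_intensity (@binary_cube R nu) (@first_order R nu) u)
    (beta : 'cV[R]_nu.+1) :
  let q := qstar u beta in
  locally_A_optimal (@binary_cube R nu) (@first_order R nu) u beta
    (xistar u beta)
  <->
  (forall x : 'cV[R]_nu, binary_cube x ->
     (q ord0) ^+ 2 * (1 - \sum_(j < nu) x j 0) ^+ 2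
       + \sum_(i < nu) (q (lift ord0 i)) ^+ 2 * (x i 0) ^+ 2
       + 2 * q ord0 / Num.sqrt nu.+1%:R
           * (\sum_(j < nu) x j 0 - 1) * (\sum_(i < nu) q (lift ord0 i) * x i 0)
     <= (u x beta)^-1).
Proof.
move=> q; have u_gt0 x : binary_cube x -> 0 < u x beta by apply: hu.1.
have crit := A_optimalP u_gt0 (xistar_design u_gt0) (xistar_info_unit u_gt0).
have c2_gt0 : 0 < cstar u beta ^+ 2 by rewrite exprn_gt0 ?cstar_gt0.
have equiv x : binary_cube x ->
    (u x beta * sqnorm (invmx (info_mx (@first_order R nu) u (xistar u beta) beta)
       *m first_order x)
     <= \tr (invmx (info_mx (@first_order R nu) u (xistar u beta) beta)))
    = (q ord0 ^+ 2 * (1 - \sum_(j < nu) x j 0) ^+ 2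
       + \sum_(i < nu) q (lift ord0 i) ^+ 2 * x i 0 ^+ 2
       + 2 * q ord0 / Num.sqrt nu.+1%:R
           * (\sum_(j < nu) x j 0 - 1) * (\sum_(i < nu) q (lift ord0 i) * x i 0)
       <= (u x beta)^-1).
  move=> Xx; rewrite xistar_mxtrace // xistar_sensitivity // mulrCA.
  by rewrite ger_pMr // -ler_pdivlMl ?u_gt0 // mulr1.
by split=> [/crit|] opt; [|apply/crit] => x Xx; move: (opt x Xx); rewrite equiv.
Qed.
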